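(* Let $N\ge3$ and $i,j\in\mathbb{Z}/N\mathbb{Z}$. The automorphism $T_i$ of the affine Yangian $Y(\hat{\mathfrak{sl}}_N)$ satisfies $$T_i(x_{j,1}^+)=\begin{cases}-x_{i,1}^-+\frac{\hbar}{2}\{h_i,x_i^-\}&\text{if } i=j,\\ [x_i^+,x_{j,1}^+]&\text{if } a_{ij}=-1,\\ x_{j,1}^+&\text{if } a_{ij}=0,\end{cases}\qquad T_i(x_{j,1}^-)=\begin{cases}-x_{i,1}^++\frac{\hbar}{2}\{h_i,x_i^+\}&\text{if } i=j,\\ -[x_i^-,x_{j,1}^-]&\text{if } a_{ij}=-1,\\ x_{j,1}^-&\text{if } a_{ij}=0,\end{cases}$$ $$T_i(\tilde h_{j,1})=\begin{cases}-\tilde h_{i,1}-\hbar\{x_i^+,x_i^-\}&\text{if } i=j,\\ \tilde h_{j,1}+\tilde h_{i,1}+\frac{\hbar}{2}\{x_i^+,x_i^-\}+m_{ij}\frac{\varepsilon_1-\varepsilon_2}{2}h_i&\text{if } a_{ij}=-1,\\ \tilde h_{j,1}&\text{if } a_{ij}=0.\end{cases}$$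
   Context: Affine Yangian. $Y(\hat{\mathfrak{sl}}_N)$ is the $\mathbb{C}$-algebra generated by $x_{i,r}^{+},x_{i,r}^-,h_{i,r}$ ($i\in\mathbb{Z}/N\mathbb{Z}$, $r\in\mathbb{Z}_{\ge0}$) with parameters $\varepsilon_1,\varepsilon_2\in\mathbb{C}$ and relations $[h_{i,r},h_{j,s}]=0$, $[x_{i,r}^+,x_{j,s}^-]=\delta_{ij}h_{i,r+s}$, $[h_{i,0},x_{j,r}^\pm]=\pm a_{ij}x_{j,r}^\pm$, $[h_{i,r+1},x_{j,s}^\pm]-[h_{i,r},x_{j,s+1}^\pm]=\pm a_{ij}\frac{\varepsilon_1+\varepsilon_2}{2}\{h_{i,r},x_{j,s}^\pm\}-m_{ij}\frac{\varepsilon_1-\varepsilon_2}{2}[h_{i,r},x_{j,s}^\pm]$, $[x_{i,r+1}^\pm,x_{j,s}^\pm]-[x_{i,r}^\pm,x_{j,s+1}^\pm]=\pm a_{ij}\frac{\varepsilon_1+\varepsilon_2}{2}\{x_{i,r}^\pm,x_{j,s}^\pm\}-m_{ij}\frac{\varepsilon_1-\varepsilon_2}{2}[x_{i,r}^\pm,x_{j,s}^\pm]$, $\sum_{w\in\mathfrak{S}_{1-a_{ij}}}[x_{i,r_{w(1)}}^\pm,[x_{i,r_{w(2)}}^\pm,\dots,[x_{i,r_{w(1-a_{ij})}}^\pm,x_{j,s}^\pm]\dots]]=0$ for $i\ne j$. Here $\{x,y\}=xy+yx$; $a_{ij}=2$ if $i=j$, $-1$ if $i=j\pm1$, $0$ otherwise;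 $m_{ij}=1$ if $j=i-1$, $-1$ if $j=i+1$, $0$ otherwise. Put $\hbar=\varepsilon_1+\varepsilon_2$, $x_i^\pm=x_{i,0}^\pm$, $h_i=h_{i,0}$, $\tilde h_{i,1}=h_{i,1}-\frac{\hbar}{2}h_i^2$. Braid operators: $T_i=\exp\mathrm{ad}\,x_i^+\,\exp\mathrm{ad}(-x_i^-)\,\exp\mathrm{ad}\,x_i^+$, an algebra automorphism of $Y(\hat{\mathfrak{sl}}_N)$ (the $\mathrm{ad}\,x_i^\pm$ are locally nilpotent). *)

(* Defs.v *)
From HB Require Import structures.
From mathcomp Require Import all_boot all_order all_fingroup all_algebra.
From mathcomp Require Import generic_quotient ring_quotient.
From mathcomp Require Import finmap boolp reals.
From mathcomp Require Import complex monalg.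

Set Implicit Arguments.
Unset Strict Implicit.
Unset Printing Implicit Defensive.

Import Order.TTheory GRing.Theory Num.Theory.

Local Open Scope ring_scope.
Local Open Scope quotient_scope.

Definition word (I : choiceType) : Type := seq I.

HB.instance Definition _ (I : choiceType) := Choice.on (word I).

Lemma word_unit (I : choiceType) (u v : word I) :
  u ++ v = [::] -> u = [::] /\ v = [::].
Proof. by case: u. Qed.

HB.instance Definition _ (I : choiceType) := Choice_isMonomialDef.Build (word I)
  (@catA I) (@cat0s I) (@cats0 I) (@word_unit I).

(* The monoid algebra of the free monoid; with the free monoid {fmonom I} of
   monalg, unification diverges. The alias keeps the algType instance below
   from overlapping with the commutative one of monalg. *)
Definition free_alg (K : comNzRingType) (I : choiceType) : Type :=
  {malg K[word I]}.

(* This definition and a few more below are locked because unification must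
   not unfold them down to finitely supported functions. *)
HB.lock Definition free_gen (K : comNzRingType) (I : choiceType) (g : I) :
  free_alg K I := << ([:: g] : word I) >>.

Section FreeAlg.
Variables (K : comNzRingType) (I : choiceType).

HB.instance Definition _ := GRing.Lalgebra.on (free_alg K I).

Lemma malg_scaleAr (c : K) (x y : {malg K[word I]}) :
  c *: (x * y) = x * (c *: y).
Proof.
apply/malgP => k; rewrite mcoeffZ.
rewrite (mcoeffMlw k (fsubset_refl _) (msuppZ_le c y)) mcoeffMl mulr_sumr.
apply: eq_bigr => k1 _; rewrite mulr_sumr; apply: eq_bigr => k2 _.
by rewrite mcoeffZ mulrnAr mulrCA.
Qed.

Lemma malgU_scale (c : K) (k : word I) :
  << c *g k >> = c *: << k >> :> {malg K[word I]}.
Proof. by apply/malgP => k'; rewrite mcoeffZ !mcoeffU mulrnAr mulr1. Qed.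

Lemma free_alg_scaleAr (c : K) (x y : free_alg K I) :
  c *: (x * y) = x * (c *: y).
Proof. exact: malg_scaleAr. Qed.

HB.instance Definition _ :=
  GRing.Lalgebra_isAlgebra.Build K (free_alg K I) free_alg_scaleAr.

Local Notation free_gen := (free_gen K).

Definition free_aug (x : free_alg K I) : K := x@_mone.

Lemma free_aug_zmod_morphism : zmod_morphism free_aug.
Proof. exact: (raddfB (mcoeff mone : {malg K[word I]} -> K)). Qed.

Lemma free_aug_monoid_morphism : monoid_morphism free_aug.
Proof. by have [h1 hM] := @mcoeff1g_is_multiplicative (word I) K; split. Qed.

Lemma free_aug_scalable : scalable_for *%R free_aug.
Proof. by move=> c x; apply: mcoeffZ. Qed.

HB.instance Definition _ := GRing.isZmodMorphism.Build (free_alg K I) K free_aug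
  free_aug_zmod_morphism.
HB.instance Definition _ := GRing.isMonoidMorphism.Build (free_alg K I) K
  free_aug free_aug_monoid_morphism.
HB.instance Definition _ := GRing.isScalable.Build K (free_alg K I) K *%R
  free_aug free_aug_scalable.

Lemma free_aug_gen g : free_aug (free_gen g) = 0.
Proof. by rewrite /free_aug unlock mcoeffU1. Qed.

Lemma free_alg_ind (P : free_alg K I -> Prop) :
  (forall g, P (free_gen g)) -> P 1 ->
  (forall x y, P x -> P y -> P (x + y)) ->
  (forall x y, P x -> P y -> P (x * y)) ->
  (forall c x, P x -> P (c *: x)) -> forall x, P x.
Proof.
move=> Pg P1 PD PM PZ x.
have P0 : P 0 by rewrite -[0](scale0r (1 : free_alg K I)); apply: PZ.
have -> : x = \sum_(k <- msupp x) << x@_k *g k >> by exact: monalgE.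
elim/big_ind : _ => // k _.
have -> : << x@_k *g k >> = x@_k *: (<< k >> : free_alg K I).
  exact: malgU_scale.
apply: PZ; elim: k => [|g s IH]; first exact: P1.
have -> : (<< (g :: s : word I) >> : free_alg K I)
          = free_gen g * << (s : word I) >>.
  by rewrite unlock [RHS]malgM_def fgmulUU mulr1.
exact: PM.
Qed.

End FreeAlg.

Inductive ideal_gen (A : nzRingType) (rel : A -> A -> Prop) : A -> Prop :=
| ideal_rel l r of rel l r : ideal_gen rel (l - r)
| ideal_0 : ideal_gen rel 0
| ideal_add x y of ideal_gen rel x & ideal_gen rel y : ideal_gen rel (x + y)
| ideal_mull a x of ideal_gen rel x : ideal_gen rel (a * x)
| ideal_mulr a x of ideal_gen rel x : ideal_gen rel (x * a).

Section QuotAlg.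
Variables (K : comNzRingType) (A : algType K) (rel : A -> A -> Prop).

Definition ideal_pred : {pred A} := fun x => `[< ideal_gen rel x >].

Lemma ideal_predP x : reflect (ideal_gen rel x) (x \in ideal_pred).
Proof. exact: asboolP. Qed.

Lemma ideal_zmod_closed : zmod_closed ideal_pred.
Proof.
split=> [|x y /ideal_predP hx /ideal_predP hy]; apply/ideal_predP.
  exact: ideal_0.
by apply: ideal_add => //; rewrite -mulN1r; apply: ideal_mull.
Qed.

HB.instance Definition _ :=
  GRing.isZmodClosed.Build A ideal_pred ideal_zmod_closed.

(* nzRingType and algType require 1 != 0, whence the proof argument. *)
Definition quot_alg (proper : ~ ideal_gen rel 1) : Type :=
  Quotient.quot ideal_pred.

End QuotAlg.

HB.instance Definition _ (K : comNzRingType) (A : algType K)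
  (rel : A -> A -> Prop) (proper : ~ ideal_gen rel 1) :=
  GRing.Zmodule.on (quot_alg proper).

HB.lock Definition quot_pi (K : comNzRingType) (A : algType K)
  (rel : A -> A -> Prop) (proper : ~ ideal_gen rel 1) (x : A) :
  quot_alg proper := \pi_(Quotient.quot (ideal_pred rel)) x.

Definition quot_rep (K : comNzRingType) (A : algType K)
  (rel : A -> A -> Prop) (proper : ~ ideal_gen rel 1) (q : quot_alg proper) : A :=
  repr (q : Quotient.quot (ideal_pred rel)).

HB.lock Definition quot_mul (K : comNzRingType) (A : algType K)
  (rel : A -> A -> Prop) (proper : ~ ideal_gen rel 1) (p q : quot_alg proper) :
  quot_alg proper := quot_pi proper (quot_rep p * quot_rep q).

HB.lock Definition quot_scale (K : comNzRingType) (A : algType K)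
  (rel : A -> A -> Prop) (proper : ~ ideal_gen rel 1) (c : K)
  (q : quot_alg proper) : quot_alg proper := quot_pi proper (c *: quot_rep q).

Section QuotAlgTheory.
Variables (K : comNzRingType) (A : algType K) (rel : A -> A -> Prop).
Variable proper : ~ ideal_gen rel 1.
Local Notation ideal_pred := (ideal_pred rel).
Local Notation Q := (quot_alg proper).
Local Notation quot_pi := (quot_pi proper).
Local Notation quot_mul := (@quot_mul K A rel proper).
Local Notation quot_scale := (@quot_scale K A rel proper).
Local Notation quot_one := (quot_pi 1 : Q).

Lemma quot_piP x y : quot_pi x = quot_pi y <-> ideal_gen rel (x - y).
Proof.
split=> [/eqP|h]; first by rewrite unlock piE Quotient.equivE => /ideal_predP.
by apply/eqP; rewrite unlock piE Quotient.equivE; apply/ideal_predP.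
Qed.

Lemma quot_pi_surj (q : Q) : exists x, q = quot_pi x.
Proof. by exists (repr (q : (Quotient.quot ideal_pred))); rewrite unlock reprK. Qed.

Lemma quot_piB x y : quot_pi (x - y) = quot_pi x - quot_pi y.
Proof. by rewrite unlock !piE. Qed.

Lemma quot_piD x y : quot_pi (x + y) = quot_pi x + quot_pi y.
Proof. by rewrite unlock !piE. Qed.

Lemma quot_repK (q : Q) : quot_pi (quot_rep q) = q.
Proof. by rewrite unlock; apply: reprK. Qed.

Lemma quot_piM x y : quot_pi (x * y) = quot_mul (quot_pi x) (quot_pi y).
Proof.
rewrite quot_mul.unlock; apply/quot_piP.
set x' := quot_rep _; set y' := quot_rep _.
have hx : ideal_gen rel (x - x') by apply/quot_piP; rewrite quot_repK.
have hy : ideal_gen rel (y - y') by apply/quot_piP; rewrite quot_repK.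
have -> : x * y - x' * y' = (x - x') * y + x' * (y - y').
  by rewrite mulrBl mulrBr addrA subrK.
by apply: ideal_add; [apply: ideal_mulr | apply: ideal_mull].
Qed.

Lemma quot_piZ c x : quot_pi (c *: x) = quot_scale c (quot_pi x).
Proof.
rewrite quot_scale.unlock; apply/quot_piP; rewrite -scalerBr -[_ - _]mul1r scalerAl.
by apply: ideal_mull; apply/quot_piP; rewrite quot_repK.
Qed.

Local Ltac lift_quot := repeat (let x := fresh in move=> x;
  try have [? ->] := quot_pi_surj x).

Lemma quot_mulA : associative quot_mul.
Proof. by lift_quot; rewrite -!quot_piM mulrA. Qed.
Lemma quot_mul1 : left_id quot_one quot_mul.
Proof. by lift_quot; rewrite -!quot_piM mul1r. Qed.
Lemma quot_mulr1 : right_id quot_one quot_mul.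
Proof. by lift_quot; rewrite -!quot_piM mulr1. Qed.
Lemma quot_mulDl : left_distributive quot_mul +%R.
Proof. by lift_quot; rewrite -!(quot_piM, quot_piD) mulrDl. Qed.
Lemma quot_mulDr : right_distributive quot_mul +%R.
Proof. by lift_quot; rewrite -!(quot_piM, quot_piD) mulrDr. Qed.
Lemma quot_one_neq0 : quot_one != 0.
Proof.
have <- : quot_pi 0 = 0 by rewrite -[in LHS](subrr 0) quot_piB subrr.
by apply/eqP => /quot_piP; rewrite subr0.
Qed.

HB.instance Definition _ := GRing.Zmodule_isNzRing.Build Q
  quot_mulA quot_mul1 quot_mulr1 quot_mulDl quot_mulDr quot_one_neq0.

Lemma quot_scaleA c d (q : Q) :
  quot_scale c (quot_scale d q) = quot_scale (c * d) q.
Proof. by have [x ->] := quot_pi_surj q; rewrite -!quot_piZ scalerA. Qed.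
Lemma quot_scale1 : left_id 1 quot_scale.
Proof. by move=> q; have [x ->] := quot_pi_surj q; rewrite -quot_piZ scale1r. Qed.
Lemma quot_scaleDr : right_distributive quot_scale +%R.
Proof.
move=> c p q; have [x ->] := quot_pi_surj p; have [y ->] := quot_pi_surj q.
by rewrite -!(quot_piZ, quot_piD) scalerDr.
Qed.
Lemma quot_scaleDl (q : Q) : {morph quot_scale^~ q : c d / c + d}.
Proof.
move=> c d; have [x ->] := quot_pi_surj q.
by rewrite -!(quot_piZ, quot_piD) scalerDl.
Qed.

HB.instance Definition _ := GRing.Zmodule_isLmodule.Build K Q
  quot_scaleA quot_scale1 quot_scaleDr quot_scaleDl.

Lemma quot_scaleAl c (p q : Q) : c *: (p * q) = (c *: p) * q.
Proof.
have [x ->] := quot_pi_surj p; have [y ->] := quot_pi_surj q.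
by rewrite /GRing.mul /GRing.scale /= -!(quot_piZ, quot_piM) scalerAl.
Qed.

HB.instance Definition _ := GRing.Lmodule_isLalgebra.Build K Q quot_scaleAl.

Lemma quot_scaleAr c (p q : Q) : c *: (p * q) = p * (c *: q).
Proof.
have [x ->] := quot_pi_surj p; have [y ->] := quot_pi_surj q.
by rewrite /GRing.mul /GRing.scale /= -!(quot_piZ, quot_piM) scalerAr.
Qed.

HB.instance Definition _ := GRing.Lalgebra_isAlgebra.Build K Q quot_scaleAr.

Lemma quot_pi_zmod_morphism : zmod_morphism quot_pi.
Proof. exact: quot_piB. Qed.
Lemma quot_pi_monoid_morphism : monoid_morphism quot_pi.
Proof. by split=> // x y; rewrite quot_piM. Qed.
Lemma quot_pi_scalable : scalable quot_pi.
Proof. by move=> c x; rewrite quot_piZ. Qed.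

HB.instance Definition _ :=
  GRing.isZmodMorphism.Build A Q quot_pi quot_pi_zmod_morphism.
HB.instance Definition _ :=
  GRing.isMonoidMorphism.Build A Q quot_pi quot_pi_monoid_morphism.
HB.instance Definition _ :=
  GRing.isScalable.Build K A Q *:%R quot_pi quot_pi_scalable.

End QuotAlgTheory.

HB.lock Definition lie (A : pzRingType) (x y : A) : A := x * y - y * x.
HB.lock Definition anti (A : pzRingType) (x y : A) : A := x * y + y * x.

Lemma lieE (A : pzRingType) (x y : A) : lie x y = x * y - y * x.
Proof. by rewrite unlock. Qed.

Lemma antiE (A : pzRingType) (x y : A) : anti x y = x * y + y * x.
Proof. by rewrite unlock. Qed.

Lemma lieC (A : pzRingType) (x y : A) : lie x y = - lie y x.
Proof. by rewrite !lieE opprB. Qed.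

Definition ad_nilp_at (A : pzRingType) (x y : A) : Prop :=
  exists n, iter n (lie x) y = 0.

Definition ad_loc_nilp (A : pzRingType) (x : A) : Prop :=
  forall y : A, ad_nilp_at x y.

(* Value at y of exp (ad x) = \sum_k (ad x)^k / k!, summed up to the order at
   which ad x kills y; the junk value 0 never occurs when ad_loc_nilp x. *)
Definition expad (K : numFieldType) (A : algType K) (x y : A) : A :=
  if pselect (exists n, iter n (lie x) y == 0) is left ex
  then \sum_(k < ex_minn ex) (k`!%:R : K)^-1 *: iter k (lie x) y
  else 0.

Section AdTheory.
Variables (K : numFieldType) (A : algType K) (x : A).
Implicit Types y z : A.
Local Notation D := (lie x).

Lemma lieD y z : D (y + z) = D y + D z.
Proof. by rewrite !lieE mulrDr mulrDl opprD addrACA. Qed.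

Lemma lieZ (c : K) y : D (c *: y) = c *: D y.
Proof. by rewrite !lieE -scalerAr -scalerAl scalerBr. Qed.

Lemma lie0 : D 0 = 0. Proof. by rewrite !lieE mulr0 mul0r subrr. Qed.

Lemma lieM y z : D (y * z) = D y * z + y * D z.
Proof. by rewrite !lieE mulrBl mulrBr !mulrA addrA subrK. Qed.

Lemma lie1 : D 1 = 0. Proof. by rewrite !lieE mulr1 mul1r subrr. Qed.

Lemma lie_sum I (r : seq I) (P : pred I) (F : I -> A) :
  D (\sum_(i <- r | P i) F i) = \sum_(i <- r | P i) D (F i).
Proof. by apply: (big_morph D lieD lie0). Qed.

Lemma iter_lieD n y z : iter n D (y + z) = iter n D y + iter n D z.
Proof. by elim: n => //= n ->; rewrite lieD. Qed.

Lemma iter_lieZ n (c : K) y : iter n D (c *: y) = c *: iter n D y.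
Proof. by elim: n => //= n ->; rewrite lieZ. Qed.

Lemma iter_lie0 n : iter n D 0 = 0.
Proof. by elim: n => //= n ->; rewrite lie0. Qed.

Lemma iter_lie_ge m n y : iter m D y = 0 -> (m <= n)%N -> iter n D y = 0.
Proof. by move=> h /subnK <-; rewrite iterD h iter_lie0. Qed.

Let fact_neq0 n : (n`!%:R : K) != 0.
Proof. by rewrite pnatr_eq0 -lt0n fact_gt0. Qed.

Definition dpow n y : A := (n`!%:R : K)^-1 *: iter n D y.

Lemma dpow0 y : dpow 0 y = y. Proof. by rewrite /dpow invr1 scale1r. Qed.

Lemma dpowS n y : (n.+1%:R : K) *: dpow n.+1 y = D (dpow n y).
Proof.
rewrite /dpow scalerA factS natrM invfM mulrA mulfV ?pnatr_eq0 // mul1r.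
by rewrite lieZ.
Qed.

Lemma dpowD n y z : dpow n (y + z) = dpow n y + dpow n z.
Proof. by rewrite /dpow iter_lieD scalerDr. Qed.

Lemma dpowZ n c y : dpow n (c *: y) = c *: dpow n y.
Proof. by rewrite /dpow iter_lieZ !scalerA mulrC. Qed.

Lemma dpow_ge m n y : iter m D y = 0 -> (m <= n)%N -> dpow n y = 0.
Proof. by move=> h le_mn; rewrite /dpow (iter_lie_ge h le_mn) scaler0. Qed.

Lemma dpowM n y z : dpow n (y * z) = \sum_(k < n.+1) dpow k y * dpow (n - k) z.
Proof.
elim: n => [|n IH]; first by rewrite big_ord1 !dpow0.
have nz : (n.+1%:R : K) != 0 by rewrite pnatr_eq0.
apply: (scalerI nz); rewrite dpowS IH lie_sum.
under eq_bigr => k _ do rewrite lieM.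
rewrite big_split /=.
have -> : \sum_(k < n.+1) D (dpow k y) * dpow (n - k) z
    = \sum_(k < n.+2) (k%:R : K) *: (dpow k y * dpow (n.+1 - k) z).
  rewrite [RHS]big_ord_recl scale0r add0r; apply: eq_bigr => k _.
  by rewrite -dpowS scalerAl /= subSS.
have -> : \sum_(k < n.+1) dpow k y * D (dpow (n - k) z)
    = \sum_(k < n.+2) ((n.+1 - k)%:R : K) *: (dpow k y * dpow (n.+1 - k) z).
  rewrite [RHS]big_ord_recr /= subnn scale0r addr0; apply: eq_bigr => k _.
  by rewrite -dpowS scalerAr subSn // -ltnS.
rewrite -big_split scaler_sumr; apply: eq_bigr => k _ /=.
by rewrite -scalerDl -natrD subnKC // -ltnS.
Qed.

Lemma iter_lieM_eq0 m n y z :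
  iter m D y = 0 -> iter n D z = 0 -> iter (m + n) D (y * z) = 0.
Proof.
move=> hy hz.
suff : dpow (m + n) (y * z) = 0.
  move/eqP; rewrite /dpow scaler_eq0 invr_eq0 (negbTE (fact_neq0 _)).
  by move=> /eqP.
rewrite dpowM big1 // => k _; case: (leqP m k) => hk.
  by rewrite (dpow_ge hy hk) mul0r.
by rewrite (dpow_ge hz) ?mulr0 // -[leqLHS](addKn m n) leq_sub2l // ltnW.
Qed.

Local Notation ad_nilp_at := (ad_nilp_at x).

Lemma ad_nilp_atD y z : ad_nilp_at y -> ad_nilp_at z -> ad_nilp_at (y + z).
Proof.
move=> [m hm] [n hn]; exists (maxn m n).
by rewrite iter_lieD (iter_lie_ge hm) ?(iter_lie_ge hn) ?leq_maxl ?leq_maxr ?addr0.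
Qed.

Lemma ad_nilp_atM y z : ad_nilp_at y -> ad_nilp_at z -> ad_nilp_at (y * z).
Proof.
by move=> [m hm] [n hn]; exists (m + n)%N; rewrite iter_lieM_eq0.
Qed.

Lemma ad_nilp_atZ c y : ad_nilp_at y -> ad_nilp_at (c *: y).
Proof. by move=> [m hm]; exists m; rewrite iter_lieZ hm scaler0. Qed.

Lemma ad_nilp_at0 : ad_nilp_at 0. Proof. by exists 0. Qed.

Lemma ad_nilp_at1 : ad_nilp_at 1. Proof. by exists 1%N; rewrite /= lie1. Qed.

Lemma ad_nilp_lie y : ad_nilp_at (D y) -> ad_nilp_at y.
Proof. by move=> [n hn]; exists n.+1; rewrite iterSr. Qed.

Lemma ad_nilp_atB y z : ad_nilp_at y -> ad_nilp_at z -> ad_nilp_at (y - z).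
Proof.
by move=> hy hz; apply: ad_nilp_atD => //; rewrite -scaleN1r; apply: ad_nilp_atZ.
Qed.

Lemma ad_nilp_at_lie y z : ad_nilp_at y -> ad_nilp_at z -> ad_nilp_at (lie y z).
Proof.
by move=> hy hz; rewrite lieE; apply: ad_nilp_atB; apply: ad_nilp_atM.
Qed.

Lemma ad_nilp_at_rhs y z (c1 c2 : K) : ad_nilp_at y -> ad_nilp_at z ->
  ad_nilp_at (c1 *: anti y z - c2 *: lie y z).
Proof.
move=> hy hz; apply: ad_nilp_atB; apply: ad_nilp_atZ; last exact: ad_nilp_at_lie.
by rewrite antiE; apply: ad_nilp_atD; apply: ad_nilp_atM.
Qed.

Lemma ad_nilp_at_step y z d (c1 c2 : K) : ad_nilp_at d -> ad_nilp_at z ->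
  lie y x - d = c1 *: anti z x - c2 *: lie z x -> ad_nilp_at y.
Proof.
move=> hd hz /(canRL (subrK _)) e.
have hx : ad_nilp_at x by exists 1%N; rewrite /= lieE subrr.
apply: ad_nilp_lie; rewrite lieC -scaleN1r e; apply: ad_nilp_atZ.
by apply: ad_nilp_atD => //; apply: ad_nilp_at_rhs.
Qed.

Lemma expadE n y : iter n D y = 0 -> expad x y = \sum_(k < n) dpow k y.
Proof.
move=> hn; rewrite /expad; case: pselect => [ex|]; last first.
  by case; exists n; rewrite hn.
case: ex_minnP => m /eqP hm min_m.
have le_mn : (m <= n)%N by apply: min_m; rewrite hn.
rewrite -[RHS](big_mkord xpredT (dpow^~ y)) (big_cat_nat (leq0n m) le_mn) /= big_mkord.
rewrite [X in _ + X](_ : _ = 0) ?addr0 // big_nat big1 // => k /andP[le_mk _].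
exact: dpow_ge hm le_mk.
Qed.

Lemma expad_horner n y : iter n D y = 0 ->
  expad x y = (\poly_(k < n) dpow k y).[1].
Proof.
move=> /expadE ->; rewrite horner_poly.
by apply: eq_bigr => k _; rewrite expr1n mulr1.
Qed.

Hypothesis x_nilp : ad_loc_nilp x.

Lemma expad_zmod_morphism : zmod_morphism (expad x).
Proof.
have expD y z : expad x (y + z) = expad x y + expad x z.
  have [m hm] := x_nilp y; have [n hn] := x_nilp z.
  have ym := iter_lie_ge hm (leq_maxl m n).
  have zn := iter_lie_ge hn (leq_maxr m n).
  rewrite (expadE ym) (expadE zn) (@expadE (maxn m n)) ?iter_lieD ?ym ?zn ?addr0 //.
  by rewrite -big_split; apply: eq_bigr => k _; rewrite dpowD.
move=> y z; apply: (addIr (expad x z)); rewrite -expD subrK.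
by rewrite addrNK.
Qed.

Lemma expad_scalable : scalable (expad x).
Proof.
move=> c y; have [m hm] := x_nilp y.
rewrite (expadE hm) (@expadE m) ?iter_lieZ ?hm ?scaler0 // scaler_sumr.
by apply: eq_bigr => k _; rewrite dpowZ.
Qed.

Lemma expad_monoid_morphism : monoid_morphism (expad x).
Proof.
split=> [|y z]; first by rewrite (@expadE 1) /= ?lie1 // big_ord1 dpow0.
have [m hm] := x_nilp y; have [n hn] := x_nilp z.
rewrite (expad_horner hm) (expad_horner hn).
rewrite (expad_horner (iter_lieM_eq0 hm hn)) -hornerM_comm; last first.
  by rewrite /comm_poly mulr1 mul1r.
congr (_ .[1]); apply/polyP => i; rewrite coefM coef_poly.
have coefE p k (w : A) : iter p D w = 0 -> (\poly_(k < p) dpow k w)`_k = dpow k w.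
  by move=> hp; rewrite coef_poly; case: ltnP => // /(dpow_ge hp) ->.
under [RHS]eq_bigr => k _ do rewrite (coefE _ _ _ hm) (coefE _ _ _ hn).
rewrite -dpowM; case: ltnP => // h.
by rewrite (dpow_ge (iter_lieM_eq0 hm hn) h).
Qed.

Lemma iter_lieN n y : iter n (lie (- x)) y = (-1) ^+ n *: iter n D y.
Proof.
elim: n => [|n IH]; first by rewrite scale1r.
rewrite !iterS IH exprS -scalerA -lieZ scaleN1r.
by rewrite !lieE mulNr mulrN opprD.
Qed.

Lemma ad_loc_nilpN : ad_loc_nilp (- x).
Proof.
by move=> y; have [n h] := x_nilp y; exists n; rewrite iter_lieN h scaler0.
Qed.

Lemma dpow_dpow k l y :
  dpow k (dpow l y) = ((k`!%:R : K)^-1 * (l`!%:R)^-1) *: iter (k + l) D y.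
Proof. by rewrite /dpow iter_lieZ scalerA -iterD. Qed.

End AdTheory.

Lemma expadNK (K : numFieldType) (A : algType K) (x : A) :
  ad_loc_nilp x -> cancel (expad x) (expad (- x)).
Proof.
move=> x_nilp y; have [M hM] := x_nilp y.
pose phi (p : {poly K}) := \sum_(i < M) p`_i *: iter i (lie x) y.
have phiX n : phi 'X^n = iter n (lie x) y.
  rewrite /phi; case: (ltnP n M) => hn; last first.
    rewrite (iter_lie_ge hM hn) big1 // => i _.
    by rewrite coefXn ltn_eqF ?scale0r // (leq_trans _ hn).
  rewrite (bigD1 (Ordinal hn)) //= coefXn eqxx scale1r big1 ?addr0 // => i.
  by rewrite -val_eqE coefXn /= => /negbTE ->; rewrite scale0r.
have phiD : {morph phi : p q / p + q}.
  move=> p q; rewrite /phi -big_split; apply: eq_bigr => i _ /=.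
  by rewrite coefD scalerDl.
have phi0 : phi 0 = 0.
  by rewrite /phi big1 // => i _; rewrite coef0 scale0r.
have phiZ c p : phi (c *: p) = c *: phi p.
  rewrite /phi scaler_sumr; apply: eq_bigr => i _.
  by rewrite coefZ scalerA.
pose P : {poly K} := \sum_(l < M) (l`!%:R)^-1 *: 'X^l.
pose Q : {poly K} := \sum_(k < M) ((-1) ^+ k * (k`!%:R)^-1) *: 'X^k.
have D_sum k : iter k (lie x) (expad x y)
    = \sum_(l < M) (l`!%:R : K)^-1 *: iter (k + l) (lie x) y.
  rewrite (expadE hM); elim: k => [|k IH] //=; rewrite IH lie_sum.
  by apply: eq_bigr => l _; rewrite lieZ.
have hM' : iter M (lie (- x)) (expad x y) = 0.
  rewrite iter_lieN D_sum big1 ?scaler0 // => l _.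
  by rewrite (iter_lie_ge hM) ?leq_addr ?scaler0.
have -> : expad (- x) (expad x y) = phi (Q * P).
  rewrite (expadE hM') /Q mulr_suml (big_morph phi phiD phi0).
  apply: eq_bigr => k _; rewrite /dpow iter_lieN D_sum -scalerAl phiZ scalerA.
  rewrite mulrC; congr (_ *: _).
  rewrite /P mulr_sumr (big_morph phi phiD phi0); apply: eq_bigr => l _.
  by rewrite -scalerAr phiZ -exprD phiX.
have coefP l : (l < M)%N -> P`_l = (l`!%:R)^-1.
  move=> hl; rewrite /P -(poly_def M (fun l => (l`!%:R)^-1)) coef_poly hl //.
have coefQ k : (k < M)%N -> Q`_k = (-1) ^+ k * (k`!%:R)^-1.
  move=> hk; rewrite /Q.
  by rewrite -(poly_def M (fun k => (-1) ^+ k * (k`!%:R)^-1)) coef_poly hk.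
have coefQP n : (n < M)%N -> (Q * P)`_n = (n == 0)%:R.
  move=> hn; rewrite coefM.
  have nz m : (m`!%:R : K) != 0 by rewrite pnatr_eq0 -lt0n fact_gt0.
  apply: (mulfI (nz n)); rewrite mulr_sumr.
  transitivity (((1 : K) - 1) ^+ n); last first.
    by rewrite subrr expr0n; case: n {hn} => [|n]; rewrite ?mulr1 ?mulr0.
  rewrite exprBn; apply: eq_bigr => k _.
  have le_kn : (k <= n)%N by rewrite -ltnS.
  rewrite coefQ ?coefP ?(leq_ltn_trans _ hn) ?leq_subr //.
  rewrite !expr1n !mulr1 -[RHS]mulr_natr -(bin_fact le_kn) !natrM.
  rewrite [RHS]mulrC -mulrA; congr (_ * _).
  by rewrite [LHS]mulrC [X in _ * X = _]mulrC mulrA !divfK.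
rewrite /phi; have [M0|M0] := posnP M.
  rewrite big1 => [|i _]; first by move: hM; rewrite M0.
  by have := leq_trans (ltn_ord i) (eq_leq M0).
rewrite (bigD1 (Ordinal M0)) //= coefQP //= scale1r big1 ?addr0 // => i.
by rewrite -val_eqE /= => h; rewrite coefQP // (negbTE h) scale0r.
Qed.

Lemma expad_bij (K : numFieldType) (A : algType K) (x : A) :
  ad_loc_nilp x -> bijective (expad x).
Proof.
move=> hx; exists (expad (- x)); first exact: expadNK.
by move=> y; rewrite -{1}[x]opprK expadNK //; apply: ad_loc_nilpN.
Qed.

Section ExpadTriple.
Variables (K : numFieldType) (A : algType K) (x y : A).
Hypotheses (x_nilp : ad_loc_nilp x) (y_nilp : ad_loc_nilp y).

Definition expad3 (z : A) : A := expad x (expad y (expad x z)).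

Lemma expad3_zmod_morphism : zmod_morphism expad3.
Proof.
have [hx hy] := (expad_zmod_morphism x_nilp, expad_zmod_morphism y_nilp).
by move=> u v; rewrite /expad3 hx hy hx.
Qed.

Lemma expad3_monoid_morphism : monoid_morphism expad3.
Proof.
have [x1 xM] := expad_monoid_morphism x_nilp.
have [y1 yM] := expad_monoid_morphism y_nilp.
by split=> [|u v]; rewrite /expad3 ?xM ?yM ?x1 ?y1 ?x1 // xM.
Qed.

Lemma expad3_scalable : scalable expad3.
Proof.
have [hx hy] := (expad_scalable x_nilp, expad_scalable y_nilp).
by move=> c u; rewrite /expad3 hx hy hx.
Qed.

Lemma expad3_bij : bijective expad3.
Proof.
have hx := expad_bij x_nilp.
exact: (bij_comp hx (bij_comp (expad_bij y_nilp) hx)).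
Qed.

End ExpadTriple.

(* a_ij and m_ij of affine type A_(N-1). They have their intended meaning for
   3 <= N only, when i - 1, i and i + 1 are distinct. *)
Definition aff_cartan (N : nat) (i j : 'Z_N) : int :=
  if i == j then 2 else if (i == j + 1) || (i == j - 1) then -1 else 0.

Definition aff_skew (N : nat) (i j : 'Z_N) : int :=
  if j == i - 1 then 1 else if j == i + 1 then -1 else 0.

(* GenX true and GenX false stand for x^+ and x^-. *)
Inductive yangian_gen (N : nat) : Type :=
| GenX of bool & 'Z_N & nat
| GenH of 'Z_N & nat.
Arguments GenX {N}.
Arguments GenH {N}.

Section YangianGenChoice.
Variable N : nat.

Definition yangian_gen_enc (g : yangian_gen N) : option bool * 'Z_N * nat :=
  match g with GenX b i r => (Some b, i, r) | GenH i r => (None, i, r) end.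

Definition yangian_gen_dec (t : option bool * 'Z_N * nat) : yangian_gen N :=
  match t with (Some b, i, r) => GenX b i r | (None, i, r) => GenH i r end.

Lemma yangian_gen_encK : cancel yangian_gen_enc yangian_gen_dec.
Proof. by case. Qed.

HB.instance Definition _ :=
  Choice.copy (yangian_gen N) (can_type yangian_gen_encK).

End YangianGenChoice.

Section Yangian.
Variables (K : numFieldType) (N : nat) (e1 e2 : K).

Local Notation F := (free_alg K (yangian_gen N)).
Local Notation X b i r := (free_gen K (GenX b i r)).
Local Notation H i r := (free_gen K (GenH i r)).
Local Notation a i j := ((aff_cartan i j)%:~R : K).
Local Notation m i j := ((aff_skew i j)%:~R : K).

Definition pm (b : bool) : K := if b then 1 else -1.

(* [u_(r 0), [u_(r 1), ... [u_(r (n - 1)), y]...]] *)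
Definition nested_lie (A : pzRingType) (n : nat) (u : nat -> A) (r : 'I_n -> nat)
  (y : A) : A := foldr (fun k z => lie (u (r k)) z) y (enum 'I_n).

Inductive yangian_rel : F -> F -> Prop :=
| yrel_hh i j r s :
    yangian_rel (lie (H i r) (H j s)) 0
| yrel_xx i j r s :
    yangian_rel (lie (X true i r) (X false j s)) (H i (r + s) *+ (i == j))
| yrel_h0x b i j r :
    yangian_rel (lie (H i 0) (X b j r)) ((pm b * a i j) *: X b j r)
| yrel_hx b i j r s :
    yangian_rel (lie (H i r.+1) (X b j s) - lie (H i r) (X b j s.+1))
      ((pm b * a i j * ((e1 + e2) / 2)) *: anti (H i r) (X b j s)
       - (m i j * ((e1 - e2) / 2)) *: lie (H i r) (X b j s))
| yrel_xsx b i j r s :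
    yangian_rel (lie (X b i r.+1) (X b j s) - lie (X b i r) (X b j s.+1))
      ((pm b * a i j * ((e1 + e2) / 2)) *: anti (X b i r) (X b j s)
       - (m i j * ((e1 - e2) / 2)) *: lie (X b i r) (X b j s))
| yrel_serre b i j (r : 'I_(`|1 - aff_cartan i j|) -> nat) s of i != j :
    yangian_rel
      (\sum_(w : 'S_(`|1 - aff_cartan i j|))
         nested_lie (fun t => X b i t) (fun k => r (w k)) (X b j s)) 0.

Lemma yangian_proper : ~ ideal_gen yangian_rel 1.
Proof.
have aug_lie (u v : F) : free_aug (lie u v) = 0.
  by rewrite !lieE rmorphB !rmorphM mulrC subrr.
have aug_anti g (v : F) : free_aug (anti (free_gen K g) v) = 0.
  by rewrite !antiE rmorphD !rmorphM /= free_aug_gen mul0r mulr0 addr0.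
have augB0 (u v : F) : free_aug u = 0 -> free_aug v = 0 -> free_aug (u - v) = 0 :> K.
  by move=> hu hv; rewrite rmorphB /= hu hv subrr.
have augZ0 c (u : F) : free_aug u = 0 -> free_aug (c *: u) = 0 :> K.
  by move=> hu; rewrite linearZ /= hu mulr0.
have aug0 : free_aug (0 : F) = 0 by rewrite rmorph0.
suff ideal0 z : ideal_gen yangian_rel z -> free_aug z = 0.
  by move=> /ideal0/eqP; rewrite rmorph1 oner_eq0.
elim=> {z} [l r [i j p q|i j p q|b i j p|b i j p q|b i j p q|b i j p q ne_ij]
           ||x y _ hx _ hy|c x _ hx|c x _ hx].
- by apply: (augB0 _ _ (aug_lie _ _)).
- apply: (augB0 _ _ (aug_lie _ _)).
  by case: (i == j); [exact: free_aug_gen | exact: aug0].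
- exact: (augB0 _ _ (aug_lie _ _) (augZ0 _ _ (free_aug_gen _ _))).
- apply: (augB0 _ _ (augB0 _ _ (aug_lie _ _) (aug_lie _ _))).
  exact: (augB0 _ _ (augZ0 _ _ (aug_anti _ _)) (augZ0 _ _ (aug_lie _ _))).
- apply: (augB0 _ _ (augB0 _ _ (aug_lie _ _) (aug_lie _ _))).
  exact: (augB0 _ _ (augZ0 _ _ (aug_anti _ _)) (augZ0 _ _ (aug_lie _ _))).
- apply: augB0 => //; rewrite rmorph_sum big1 // => w _.
  rewrite /nested_lie; case: (enum _) => [|k s] /=; first exact: free_aug_gen.
  exact: aug_lie.
- exact: aug0.
- by rewrite rmorphD /= hx hy addr0.
- by rewrite rmorphM /= hx mulr0.
- by rewrite rmorphM /= hx mul0r.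
Qed.

Definition yangian : Type := quot_alg yangian_proper.

HB.instance Definition _ := GRing.Algebra.on yangian.

Definition yangian_pi : F -> yangian := quot_pi yangian_proper.

Definition yx (b : bool) (i : 'Z_N) (r : nat) : yangian := yangian_pi (X b i r).
Definition yxp : 'Z_N -> nat -> yangian := yx true.
Definition yxm : 'Z_N -> nat -> yangian := yx false.
Definition yh (i : 'Z_N) (r : nat) : yangian := yangian_pi (H i r).
Definition yht (i : 'Z_N) : yangian :=
  yh i 1 - ((e1 + e2) / 2) *: (yh i 0) ^+ 2.

Definition braid (i : 'Z_N) (y : yangian) : yangian :=
  expad (yxp i 0) (expad (- yxm i 0) (expad (yxp i 0) y)).

Section YangianTheory.

HB.instance Definition _ := GRing.LRMorphism.on yangian_pi.

Lemma yangian_pi_rel l r : yangian_rel l r -> yangian_pi l = yangian_pi r.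
Proof. by move=> h; apply/quot_piP; apply: ideal_rel. Qed.

Lemma yangian_piB (u v : F) : yangian_pi (u - v) = yangian_pi u - yangian_pi v.
Proof. exact: rmorphB. Qed.

Lemma yangian_piZ c (u : F) : yangian_pi (c *: u) = c *: yangian_pi u.
Proof. exact: linearZ. Qed.

Lemma yangian_pi_lie u v :
  yangian_pi (lie u v) = lie (yangian_pi u) (yangian_pi v).
Proof. by rewrite !lieE rmorphB !rmorphM. Qed.

Lemma yangian_pi_anti u v :
  yangian_pi (anti u v) = anti (yangian_pi u) (yangian_pi v).
Proof. by rewrite !antiE rmorphD !rmorphM. Qed.

Lemma yangian_ind (P : yangian -> Prop) :
  (forall b i r, P (yx b i r)) -> (forall i r, P (yh i r)) -> P 1 ->
  (forall x y, P x -> P y -> P (x + y)) ->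
  (forall x y, P x -> P y -> P (x * y)) ->
  (forall c x, P x -> P (c *: x)) -> forall x, P x.
Proof.
move=> Px Ph P1 PD PM PZ x.
have [y ->] := quot_pi_surj (x : quot_alg yangian_proper).
rewrite -/(yangian_pi y).
elim/free_alg_ind: y => [[b i r|i r]||u v hu hv|u v hu hv|c u hu].
- exact: Px.
- exact: Ph.
- by rewrite rmorph1.
- by rewrite rmorphD; apply: PD.
- by rewrite rmorphM; apply: PM.
- by rewrite linearZ; apply: PZ.
Qed.

Lemma lie_hh i j r s : lie (yh i r) (yh j s) = 0.
Proof. by rewrite -yangian_pi_lie (yangian_pi_rel (yrel_hh _ _ _ _)) rmorph0. Qed.

Lemma lie_xx i j r s : lie (yxp i r) (yxm j s) = yh i (r + s) *+ (i == j).
Proof. by rewrite -yangian_pi_lie (yangian_pi_rel (yrel_xx _ _ _ _)) rmorphMn. Qed.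

Lemma lie_h0x b i j r : lie (yh i 0) (yx b j r) = (pm b * a i j) *: yx b j r.
Proof. by rewrite -yangian_pi_lie (yangian_pi_rel (yrel_h0x _ _ _ _)) linearZ. Qed.

Lemma lie_hx b i j r s :
  lie (yh i r.+1) (yx b j s) - lie (yh i r) (yx b j s.+1)
  = (pm b * a i j * ((e1 + e2) / 2)) *: anti (yh i r) (yx b j s)
    - (m i j * ((e1 - e2) / 2)) *: lie (yh i r) (yx b j s).
Proof.
have := yangian_pi_rel (yrel_hx b i j r s).
by rewrite 2!yangian_piB !yangian_piZ !yangian_pi_lie yangian_pi_anti.
Qed.

Lemma lie_xsx b i j r s :
  lie (yx b i r.+1) (yx b j s) - lie (yx b i r) (yx b j s.+1)
  = (pm b * a i j * ((e1 + e2) / 2)) *: anti (yx b i r) (yx b j s)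
    - (m i j * ((e1 - e2) / 2)) *: lie (yx b i r) (yx b j s).
Proof.
have := yangian_pi_rel (yrel_xsx b i j r s).
by rewrite 2!yangian_piB !yangian_piZ !yangian_pi_lie yangian_pi_anti.
Qed.

Lemma yangian_serre b i j (r : 'I_(`|1 - aff_cartan i j|) -> nat) s : i != j ->
  \sum_(w : 'S_(`|1 - aff_cartan i j|))
     nested_lie (yx b i) (fun k => r (w k)) (yx b j s) = 0.
Proof.
move=> ne_ij; have := yangian_pi_rel (yrel_serre b r s ne_ij).
rewrite rmorph0 rmorph_sum /= => h; rewrite -[RHS]h; apply: eq_bigr => w _.
rewrite /nested_lie; elim: (enum _) => //= k l ->.
by rewrite yangian_pi_lie.
Qed.

Lemma yx_nilp b i : ad_loc_nilp (yx b i 0).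
Proof.
have hx : ad_nilp_at (yx b i 0) (yx b i 0) by exists 1%N; rewrite /= lieE subrr.
have hlie u v := @ad_nilp_at_lie _ _ (yx b i 0) u v.
have hx1 : ad_nilp_at (yx b i 0) (yx b i 1).
  apply: ad_nilp_lie.
  have e := lie_xsx b i i 0 0.
  have {}e : lie (yx b i 0) (yx b i 1) = - (2^-1 : K) *:
     ((pm b * a i i * ((e1 + e2) / 2)) *: anti (yx b i 0) (yx b i 0)
       - (m i i * ((e1 - e2) / 2)) *: lie (yx b i 0) (yx b i 0)).
    rewrite -e scaleNr -scalerN opprB.
    have -> : lie (yx b i 1) (yx b i 0) = - lie (yx b i 0) (yx b i 1).
      by rewrite -lieC.
    by rewrite opprK -mulr2n -scaler_nat scalerA mulVf ?scale1r ?pnatr_eq0.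
  by rewrite e; apply: ad_nilp_atZ; apply: ad_nilp_at_rhs.
have hxi r : ad_nilp_at (yx b i 0) (yx b i r).
  elim: r => [//|r IH].
  exact: (ad_nilp_at_step (hlie _ _ IH hx1) IH (lie_xsx b i i r 0)).
have hh j r : ad_nilp_at (yx b i 0) (yh j r).
  elim: r => [|r IH].
    apply: ad_nilp_lie.
    have -> : lie (yx b i 0) (yh j 0) = (-1) *: lie (yh j 0) (yx b i 0).
      by rewrite scaleN1r -lieC.
    by rewrite lie_h0x; do 2!apply: ad_nilp_atZ.
  exact: (ad_nilp_at_step (hlie _ _ IH hx1) IH (lie_hx b j i r 0)).
apply: yangian_ind => [c j r|j r||u v|u v|c u].
- have [<-{c}|ne_bc] := eqVneq b c.
    have [<-//|ne_ij] := eqVneq i j.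
    exists `|1 - aff_cartan i j|%N.
    have := yangian_serre b (fun=> 0%N) r ne_ij.
    have -> (n : nat) : \sum_(w : 'S_n)
        nested_lie (yx b i) (fun k : 'I_n => 0%N) (yx b j r)
      = (n`!%:R : K) *: iter n (lie (yx b i 0)) (yx b j r).
      rewrite sumr_const card_Sn -scaler_nat; congr (_ *: _).
      rewrite /nested_lie -[in RHS](size_enum_ord n).
      by elim: (enum _) => //= k s ->.
    move/eqP; rewrite scaler_eq0 pnatr_eq0 -leqn0 leqNgt fact_gt0 /=.
    by move/eqP.
  apply: ad_nilp_lie; case: b c ne_bc {hx hlie hx1 hxi} hh => [] [] // _ hh.
    rewrite -/(yxp i 0) -/(yxm j r) lie_xx.
    by case: eqP => _; [exact: hh | exact: ad_nilp_at0].
  have -> : lie (yx false i 0) (yx true j r) = - lie (yxp j r) (yxm i 0).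
    by rewrite -lieC.
  rewrite lie_xx -scaleN1r; apply: ad_nilp_atZ.
  by case: eqP => _; [exact: hh | exact: ad_nilp_at0].
- exact: hh.
- exact: ad_nilp_at1.
- exact: ad_nilp_atD.
- exact: ad_nilp_atM.
- exact: ad_nilp_atZ.
Qed.

Lemma yxN_nilp i : ad_loc_nilp (- yxm i 0).
Proof. exact/ad_loc_nilpN/yx_nilp. Qed.

Variable i : 'Z_N.

Lemma braid_zmod_morphism : zmod_morphism (braid i).
Proof. exact: (expad3_zmod_morphism (yx_nilp true i) (yxN_nilp i)). Qed.

Lemma braid_monoid_morphism : monoid_morphism (braid i).
Proof. exact: (expad3_monoid_morphism (yx_nilp true i) (yxN_nilp i)). Qed.

Lemma braid_scalable : scalable (braid i).
Proof. exact: (expad3_scalable (yx_nilp true i) (yxN_nilp i)). Qed.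

HB.instance Definition _ :=
  GRing.isZmodMorphism.Build yangian yangian (braid i) braid_zmod_morphism.
HB.instance Definition _ :=
  GRing.isMonoidMorphism.Build yangian yangian (braid i) braid_monoid_morphism.
HB.instance Definition _ :=
  GRing.isScalable.Build K yangian yangian *:%R (braid i) braid_scalable.

Lemma braid_bij : bijective (braid i).
Proof. exact: (expad3_bij (yx_nilp true i) (yxN_nilp i)). Qed.

End YangianTheory.

End Yangian.

(* Main.v *)
(* For the sl2-triple e = x_i^+, h = h_i, f = x_i^-, the operator T_i acts on
   every finite-dimensional ad-submodule as the Weyl group element of sl2, so it
   suffices to locate the generators of degree 1 in small submodules. For i = j
   the quadratic corrections x_{i,1}^+- - (hbar/4) {x_i^+-, h_i} and
   ht_i + (hbar/2) {x_i^+, x_i^-} span a copy of the adjoint representation.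
   For a_ij = -1, x_{j,1}^+- generates a two-dimensional module by the Serre
   relations, while ht_j + ht_i / 2 + m_ij (e1 - e2) / 4 h_i commutes with
   x_i^+-. For a_ij = 0, x_{j,1}^+- and ht_j commute with x_i^+-. *)
Require Import Defs.
From mathcomp Require Import all_boot all_order all_fingroup all_algebra.
From mathcomp Require Import reals complex ring.

Set Implicit Arguments.
Unset Strict Implicit.
Unset Printing Implicit Defensive.

Import GRing.Theory Num.Theory.
Local Open Scope ring_scope.

(** * Commutator and anticommutator calculus, with [lie x] acting as a derivation *)

Section LieAnti.
Variables (K : numFieldType) (A : algType K).
Implicit Types x y z : A.

Lemma lieN x y : lie x (- y) = - lie x y.
Proof. by rewrite -scaleN1r lieZ scaleN1r. Qed.

Lemma antiC x y : anti x y = anti y x.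
Proof. by rewrite !antiE addrC. Qed.

Lemma antiZl (c : K) x y : anti (c *: x) y = c *: anti x y.
Proof. by rewrite !antiE -scalerAl -scalerAr scalerDr. Qed.

Lemma antiZr (c : K) x y : anti x (c *: y) = c *: anti x y.
Proof. by rewrite antiC antiZl antiC. Qed.

Lemma antiNl x y : anti (- x) y = - anti x y.
Proof. by rewrite -scaleN1r antiZl scaleN1r. Qed.

Lemma antiNr x y : anti x (- y) = - anti x y.
Proof. by rewrite antiC antiNl antiC. Qed.

Lemma lie_anti x y z : lie x (anti y z) = anti (lie x y) z + anti y (lie x z).
Proof.
rewrite [in LHS]antiE lieD !lieM !antiE.
by rewrite [lie x z * y + _]addrC addrACA.
Qed.

Lemma anti_sqr x : anti x x = (2 : K) *: x ^+ 2.
Proof. by rewrite antiE expr2 scaler_nat mulr2n. Qed.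

Lemma jacobi x y z : lie x (lie y z) = lie (lie x y) z + lie y (lie x z).
Proof.
rewrite [lie y z]lieE [lie (lie x y) z]lieE [lie y (lie x z)]lieE.
by rewrite lieD lieN !lieM [lie x z * y + _]addrC opprD addrACA.
Qed.

End LieAnti.

(** * The exponential series on vectors killed by the first, second or third power of [lie x] *)

Section ExpadSmall.
Variables (K : numFieldType) (A : algType K) (x : A).

Lemma expad_fix y : lie x y = 0 -> expad x y = y.
Proof. by move=> h; rewrite (@expadE _ _ _ 1) // big_ord1 dpow0. Qed.

Lemma expad_lin y : lie x (lie x y) = 0 -> expad x y = y + lie x y.
Proof.
move=> h; rewrite (@expadE _ _ _ 2) // !big_ord_recl big_ord0 addr0 dpow0.
by rewrite /dpow /= invr1 scale1r.
Qed.

Lemma expad_quad y : lie x (lie x (lie x y)) = 0 ->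
  expad x y = y + lie x y + (2^-1 : K) *: lie x (lie x y).
Proof.
move=> h; rewrite (@expadE _ _ _ 3) // !big_ord_recl big_ord0 addr0 dpow0 addrA.
by rewrite /dpow /= invr1 scale1r.
Qed.

End ExpadSmall.

(** * The Weyl group element of sl2 on modules of dimension one, two and three *)

Section WeylAction.
Variables (K : numFieldType) (A : algType K) (e f : A).
Hypotheses (e_nilp : ad_loc_nilp e) (f_nilp : ad_loc_nilp f).

Let lieNl x y : lie (- x) y = - lie x y :> A.
Proof. by rewrite lieC lieN (lieC x y). Qed.

Let half2 (v : A) : (2^-1 : K) *: (v + v) = v.
Proof. by rewrite -mulr2n -scaler_nat scalerA mulVf ?pnatr_eq0 // scale1r. Qed.

Let expadB x y z : ad_loc_nilp x -> expad x (y - z) = expad x y - expad x z :> A.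
Proof. by move=> /expad_zmod_morphism ->. Qed.

Let expadN x y : ad_loc_nilp x -> expad x (- y) = - expad x y :> A.
Proof. by move=> hx; rewrite -[- y]add0r expadB // expad_fix ?lie0 // sub0r. Qed.

Let expadD x y z : ad_loc_nilp x -> expad x (y + z) = expad x y + expad x z :> A.
Proof. by move=> hx; rewrite -{1}[z]opprK expadB // expadN // opprK. Qed.

Lemma expad3_invariant v : lie e v = 0 -> lie f v = 0 -> expad3 e (- f) v = v.
Proof. by move=> ev fv; rewrite /expad3 !expad_fix // lieNl fv oppr0. Qed.

(** This is the standard two-dimensional representation, with highest vector [u] and lowest vector
    [w]. *)
Lemma expad3_doublet u w :
  lie e u = 0 -> lie e w = u -> lie f u = w -> lie f w = 0 ->
  expad3 e (- f) w = u /\ expad3 e (- f) u = - w.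
Proof.
move=> eu ew fu fw.
have Nf := ad_loc_nilpN f_nilp.
have Eu : expad e u = u by rewrite expad_fix.
have Ew : expad e w = w + u by rewrite expad_lin ew ?eu.
have Fw : expad (- f) w = w by rewrite expad_fix // lieNl fw oppr0.
have Fu1 : lie (- f) u = - w by rewrite lieNl fu.
have Fu : expad (- f) u = u - w.
  by rewrite expad_lin Fu1 // lieNl lieN fw !oppr0.
split; rewrite /expad3.
  by rewrite Ew expadD // Fw Fu addrC subrK Eu.
by rewrite Eu Fu expadB // Eu Ew opprD addrCA subrr addr0.
Qed.

(** The hypotheses copy the brackets of e and f with the basis e, h, f of sl2, where [u], [v], [w]
    take the places of e, h, f. *)
Lemma expad3_triplet u v w :
  lie e u = 0 -> lie e v = - (u + u) -> lie e w = v ->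
  lie f u = - v -> lie f v = w + w -> lie f w = 0 ->
  [/\ expad3 e (- f) u = - w, expad3 e (- f) v = - v
    & expad3 e (- f) w = - u].
Proof.
move=> eu ev ew fu fv fw.
have Nf := ad_loc_nilpN f_nilp.
have eev : lie e (- (u + u)) = 0 by rewrite lieN lieD eu addr0 oppr0.
have ffv : lie (- f) (- (w + w)) = 0.
  by rewrite lieNl lieN lieD fw addr0 !oppr0.
have Fv1 : lie (- f) v = - (w + w) by rewrite lieNl fv.
have Fu1 : lie (- f) u = v by rewrite lieNl fu opprK.
have Eu : expad e u = u by rewrite expad_fix.
have Ev : expad e v = v - u - u by rewrite expad_lin ev // opprD addrA.
have Ew : expad e w = w + (v - u).
  by rewrite expad_quad ew ev // scalerN half2 addrA.
have Fw : expad (- f) w = w by rewrite expad_fix // lieNl fw oppr0.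
have Fv : expad (- f) v = v - w - w by rewrite expad_lin Fv1 // opprD addrA.
have Fu : expad (- f) u = u + (v - w).
  by rewrite expad_quad Fu1 Fv1 // scalerN half2 addrA.
rewrite /expad3; split.
- rewrite Eu Fu expadD // expadB // Eu Ev Ew.
  by rewrite addrA [u + _]addrC subrK opprD addrCA subrr addr0.
- rewrite Ev 2!(expadB _ _ Nf) Fv Fu.
  (* Applying [expad (- f)] to v - 2u makes the [w] terms cancel and leaves - v - 2u, which
     [expad e] sends to - v. *)
  have -> : v - w - w - (u + (v - w)) - (u + (v - w)) = - v - u - u.
    rewrite [u + _]addrC opprD addrACA [_ - w - _]addrAC subrr add0r opprB.
    by rewrite !addrA addNr add0r.
  by rewrite 2!(expadB _ _ e_nilp) expadN // Eu Ev !opprD !opprK !addrK.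
rewrite Ew expadD // expadB // Fw Fv Fu.
have -> : w + (v - w - w - (u + (v - w))) = - u.
  by rewrite [u + _]addrC opprD addrACA subrr add0r addrA subrr add0r.
by rewrite expadN // Eu.
Qed.

End WeylAction.

(** * Symmetry of a_ij and antisymmetry of m_ij *)

Section AffineCartan.
Variable N : nat.
Implicit Types i j : 'Z_N.

Let eq_predE i j : (i == j - 1) = (j == i + 1).
Proof. by rewrite eq_sym subr_eq. Qed.

Lemma aff_cartan_refl i : aff_cartan i i = 2.
Proof. by rewrite /aff_cartan eqxx. Qed.

Lemma aff_cartan_sym i j : aff_cartan i j = aff_cartan j i.
Proof.
rewrite /aff_cartan [j == i]eq_sym; case: eqP => // _.
by rewrite (eq_predE i j) (eq_predE j i) orbC.
Qed.

Lemma aff_skew_refl i : aff_skew i i = 0.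
Proof.
have h : (i == i + 1) = false by rewrite -subr_eq0 opprD addNKr oppr_eq0 oner_eq0.
by rewrite /aff_skew eq_predE h.
Qed.

(** Exchanging i and j exchanges the cases j = i - 1 and j = i + 1. These exclude each other because
    2 is nonzero modulo N > 2. *)
Lemma aff_skew_anti i j : (2 < N)%N -> aff_skew j i = - aff_skew i j.
Proof.
move=> N_gt2; have two_neq0 : 2 != 0 :> 'Z_N.
  apply/eqP => /(congr1 (@nat_of_ord _)).
  by rewrite val_Zp_nat ?modn_small // ltnW.
rewrite /aff_skew (eq_predE i j) -(eq_predE j i); case: eqP => [e1|_]; case: eqP => [e2|_] //.
case/negP: two_neq0; rewrite -(inj_eq (addrI (i - 1))) addr0 -[eqbRHS]e2 e1.
by rewrite (natrD _ 1 1) addrA subrK.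
Qed.

End AffineCartan.

Section BraidDegreeOne.
Variables (K : numFieldType) (N : nat) (e1 e2 : K).
Implicit Types (b : bool) (i j : 'Z_N).

Local Notation Y := (yangian N e1 e2).
Local Notation x b i r := (yx e1 e2 b i r : Y).
Local Notation xp i r := (yxp e1 e2 i r : Y).
Local Notation xm i r := (yxm e1 e2 i r : Y).
Local Notation h i := (yh e1 e2 i 0 : Y).
Local Notation ht i := (yht e1 e2 i : Y).
Local Notation hbar := (e1 + e2).
Local Notation delta := ((e1 - e2) / 2).
Local Notation a i j := ((aff_cartan i j)%:~R : K).
Local Notation m i j := ((aff_skew i j)%:~R : K).
Local Notation T i := (@braid K N e1 e2 i).

(** * Brackets of x_i^+ and x_i^- with generators of degree at most one *)

Lemma lie_xh0 b i j r : lie (x b i r) (h j) = - (pm K b * a j i) *: x b i r.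
Proof. by rewrite lieC lie_h0x scaleNr. Qed.

(** The defining relation for [h_{j,1}, x_i] contains an anticommutator of h_j and x_i. The bracket
    with the quadratic term of [ht j] cancels it. *)
Lemma lie_xht b i j : lie (x b i 0) (ht j)
  = - (pm K b * a j i) *: (x b i 1 - (m j i * delta) *: x b i 0).
Proof.
rewrite /yht lieD lieN lieZ expr2 lieM lie_xh0 -scalerAl -scalerAr -scalerDr.
have := lie_hx e1 e2 b j i 0 0; move/(canRL (subrK _)).
rewrite !lie_h0x => e; rewrite lieC e antiE [_ * h j + _]addrC !scalerA.
rewrite [_ - _ + _]addrAC opprD opprD !scaleNr -!opprD scalerBr scalerA.
rewrite mulrN scaleNr [hbar / 2 * _]mulrC [X in X - _ - _]addrC.
by rewrite addrAC addrK [X in _ - X *: _]mulrC.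
Qed.

(** When all the symmetrised indices are 0, the (1 - a_ij)! summands of the Serre relation coincide,
    and the factorial is invertible in [K]. *)
Lemma yangian_serre_iter b i j r : i != j ->
  iter `|1 - aff_cartan i j| (lie (x b i 0)) (x b j r) = 0.
Proof.
move=> ne_ij; have := yangian_serre e1 e2 b (fun=> 0%N) r ne_ij.
have -> (n : nat) : \sum_(w : 'S_n)
    nested_lie (yx e1 e2 b i) (fun k : 'I_n => 0%N) (x b j r)
  = (n`!%:R : K) *: iter n (lie (x b i 0)) (x b j r).
  rewrite sumr_const card_Sn -scaler_nat; congr (_ *: _).
  rewrite /nested_lie -[in RHS](size_enum_ord n).
  by elim: (enum _) => //= k s ->.
move/eqP; rewrite scaler_eq0 pnatr_eq0 -leqn0 leqNgt fact_gt0 /=.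
by move/eqP.
Qed.

Lemma lie_x_opp b i r : lie (x b i 0) (x (~~ b) i r) = pm K b *: yh e1 e2 i r.
Proof.
have e s t := lie_xx e1 e2 i i s t.
case: b => /=; first by rewrite scale1r [LHS]e eqxx.
by rewrite lieC [lie _ _]e eqxx addn0 scaleN1r.
Qed.

Lemma lie_x_opp_ne b i j r : i != j -> lie (x b i 0) (x (~~ b) j r) = 0.
Proof.
have e k l s t := lie_xx e1 e2 k l s t.
move=> /negbTE ne_ij; case: b => /=; first by rewrite [LHS]e ne_ij.
by rewrite lieC [lie _ _]e eq_sym ne_ij oppr0.
Qed.

(** For i = j and r = s = 0 the two brackets in the quadratic relation are opposite, so dividing by
    2 isolates one of them. *)
Lemma lie_xx1 b i :
  lie (x b i 0) (x b i 1) = - (pm K b * (hbar / 2)) *: anti (x b i 0) (x b i 0).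
Proof.
have := lie_xsx e1 e2 b i i 0 0; rewrite aff_cartan_refl aff_skew_refl.
rewrite !mul0r scale0r subr0 lieC -opprD -mulr2n => /eqP; rewrite eqr_oppLR => /eqP e.
apply: (@scalerI _ _ (2 : K)); first by rewrite pnatr_eq0.
by rewrite scaler_nat e scalerA -scaleNr; congr (_ *: _); ring.
Qed.

(** * Corrected generators spanning a copy of the adjoint representation *)

Let c : K := hbar / 4.
(** The constant [c] makes [x'] commute with [x b i 0]: since [x, h] = -2x or 2x, the correction
    contributes 2c {x, x} up to sign, which cancels the hbar/2 of [lie_xx1]. *)
Let x' b i : Y := x b i 1 - c *: anti (x b i 0) (h i).
Let ht' i : Y := ht i + (hbar / 2) *: anti (x true i 0) (x false i 0).

Let c2 : 2 * c = hbar / 2. Proof. by rewrite /c; field. Qed.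

Lemma lie_x_x' b i : lie (x b i 0) (x' b i) = 0.
Proof.
rewrite /x' lieD lieN lieZ lie_xx1 lie_anti lie_xh0 aff_cartan_refl.
rewrite [lie _ (x b i 0)]lieE subrr [anti 0 _]antiE mul0r mulr0 !add0r antiZr.
rewrite -c2 scalerA -scalerBl; set k := (X in X *: _).
have -> : k = 0 by rewrite /k; ring.
by rewrite scale0r.
Qed.

Lemma lie_x_ht' b i : lie (x b i 0) (ht' i) = - (pm K b * 2) *: x' b i.
Proof.
(* The anticommutator is symmetric, so one computation serves both signs [b]. *)
have -> : ht' i = ht i + (hbar / 2) *: anti (x b i 0) (x (~~ b) i 0).
  by rewrite /ht'; case: b; rewrite // antiC.
rewrite lieD lieZ lie_xht aff_skew_refl mul0r scale0r subr0 aff_cartan_refl.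
rewrite lie_anti [lie _ (x b i 0)]lieE subrr [anti 0 _]antiE mul0r mulr0 !add0r.
rewrite lie_x_opp antiZr scalerBr !scalerA -c2; congr (_ + _).
by rewrite -scaleNr; congr (_ *: _); ring.
Qed.

(** Up to sign, the term c {h, h} = (hbar/2) h^2 turns h_{i,1} into [ht i], while the bracket of x
    with h inside the correction supplies the anticommutator of [ht']. *)
Lemma lie_x_opp' b i : lie (x b i 0) (x' (~~ b) i) = pm K b *: ht' i.
Proof.
have -> : ht' i = ht i + (hbar / 2) *: anti (x (~~ b) i 0) (x b i 0).
  by rewrite /ht'; case: b; rewrite // antiC.
rewrite /x' lieD lieN lieZ lie_anti !lie_x_opp lie_xh0 aff_cartan_refl.
rewrite antiZl antiZr anti_sqr /yht !scalerDr !scalerN !scalerA -addrA opprD -c2.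
by congr (_ + (- _ + _)); rewrite -?scaleNr; congr (_ *: _); ring.
Qed.

Let pm2 b (v : Y) : (pm K b * 2) *: v = pm K b *: (v + v).
Proof. by rewrite -scalerA scaler_nat mulr2n. Qed.

(** * The action of T_i at its own node, i = j *)

Lemma braid_degree0 i :
  [/\ T i (x true i 0) = - x false i 0, T i (h i) = - h i
    & T i (x false i 0) = - x true i 0].
Proof.
have self b : lie (x b i 0) (x b i 0) = 0 by rewrite lieE subrr.
apply: expad3_triplet; rewrite ?self ?lie_xh0 ?aff_cartan_refl //;
  try exact: yx_nilp.
- by rewrite scaleNr pm2 scale1r.
- by rewrite (lie_x_opp true) scale1r.
- by rewrite (lie_x_opp false) scaleN1r.
- by rewrite scaleNr pm2 scaleN1r opprK.
Qed.

Lemma braid_corrected i :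
  [/\ T i (x' true i) = - x' false i, T i (ht' i) = - ht' i
    & T i (x' false i) = - x' true i].
Proof.
apply: expad3_triplet; rewrite ?lie_x_x' ?lie_x_ht' //; try exact: yx_nilp.
- by rewrite scaleNr pm2 scale1r.
- by rewrite (lie_x_opp' true) scale1r.
- by rewrite (lie_x_opp' false) scaleN1r.
- by rewrite scaleNr pm2 scaleN1r opprK.
Qed.

Lemma braidZ i (k : K) (u : Y) : T i (k *: u) = k *: T i u.
Proof. exact: braid_scalable. Qed.

Lemma braidB i (u v : Y) : T i (u - v) = T i u - T i v.
Proof. exact: braid_zmod_morphism. Qed.

Lemma braidD i (u v : Y) : T i (u + v) = T i u + T i v.
Proof. exact: rmorphD. Qed.

Lemma braid_anti i (u v : Y) : T i (anti u v) = anti (T i u) (T i v).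
Proof. by rewrite !antiE rmorphD !rmorphM. Qed.

(** The signs cancel when T_i is applied to {x, h}, giving {x, h} for the opposite x. This term and
    the correction inside [x'] add up to 2c = hbar/2. *)
Lemma braid_x1_diag b i :
  T i (x b i 1) = - x (~~ b) i 1 + (hbar / 2) *: anti (h i) (x (~~ b) i 0).
Proof.
have [Te Th Tf] := braid_degree0 i; have [Te' _ Tf'] := braid_corrected i.
have Tb : T i (x b i 0) = - x (~~ b) i 0 by case: (b).
have Tb' : T i (x' b i) = - x' (~~ b) i by case: (b).
rewrite -[x b i 1](subrK (c *: anti (x b i 0) (h i))) -/(x' b i).
rewrite braidD braidZ braid_anti Tb Tb' Th antiNl antiNr opprK.
by rewrite /x' opprB addrAC -scalerDl addrC -c2 mulr_natl mulr2n antiC.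
Qed.

(** T_i fixes {x_i^+, x_i^-} and negates [ht' i], so the correction hbar/2 is counted twice. *)
Lemma braid_ht_diag i :
  T i (ht i) = - ht i - hbar *: anti (x true i 0) (x false i 0).
Proof.
have [Te Th Tf] := braid_degree0 i; have [_ Tht' _] := braid_corrected i.
rewrite -{1}[ht i](addrK ((hbar / 2) *: anti (x true i 0) (x false i 0))).
rewrite -/(ht' i) braidB braidZ braid_anti Te Tf Tht' antiNl antiNr opprK.
rewrite /ht' opprD -addrA -opprD [anti (x false i 0) _]antiC -scalerDl.
by congr (_ - _ *: _); field.
Qed.

(** * The action of T_i at a neighbouring node, a_ij = -1 *)

Lemma braid_x1_adj i j : aff_cartan i j = -1 ->
  T i (x true j 1) = lie (x true i 0) (x true j 1) /\
  T i (x false j 1) = - lie (x false i 0) (x false j 1).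
Proof.
move=> aij; have ne_ij : i != j.
  by apply/eqP => eq_ij; move: aij; rewrite eq_ij aff_cartan_refl.
have serre b := yangian_serre_iter b 1 ne_ij; rewrite aij /= in serre.
have lie_h b : lie (h i) (x b j 1) = - pm K b *: x b j 1.
  by rewrite lie_h0x aij mulrN1.
have fe : lie (x false i 0) (x true i 0) = - h i.
  by rewrite (lie_x_opp false) scaleN1r.
have ef : lie (x true i 0) (x false i 0) = h i.
  by rewrite (lie_x_opp true) scale1r.
have nilp b : ad_loc_nilp (x b i 0) by exact: yx_nilp.
split.
  (* x_{j,1}^+ has weight -1 for h_i, so it is the lowest vector [w]. The Jacobi identity recovers
     it from [x_i^+, x_{j,1}^+]. *)
  have [] := expad3_doublet (nilp true) (nilp false) (serre true) (erefl _) _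
    (lie_x_opp_ne false 1 ne_ij); last by [].
  rewrite jacobi fe (lie_x_opp_ne false) // lie0 addr0.
  by rewrite lieC lieN -lieC lie_h scaleN1r opprK.
(* x_{j,1}^- has weight 1, so it is the highest vector [u], whence the minus sign. *)
have [] := expad3_doublet (nilp true) (nilp false)
  (lie_x_opp_ne true 1 ne_ij) _ (erefl _) (serre false); last by [].
by rewrite jacobi ef (lie_x_opp_ne true) // lie0 addr0 lie_h opprK scale1r.
Qed.

Lemma braid_ht_adj i j : (2 < N)%N -> aff_cartan i j = -1 ->
  T i (ht j) = ht j + ht i + (hbar / 2) *: anti (x true i 0) (x false i 0)
               + (m i j * delta) *: h i.
Proof.
(* Both coefficients are halved because a_ii = 2 and a_ij = -1. By m_ji = - m_ij the degree-zero
   terms cancel as well. *)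
move=> N_gt2 aij; pose s := 2^-1 *: ht i + 2^-1 *: ((m i j * delta) *: h i).
have inv b : lie (x b i 0) (ht j + s) = 0.
  rewrite lieD [lie _ s]lieD !lieZ !lie_xht lie_xh0 aff_skew_refl aff_cartan_refl.
  rewrite (aff_skew_anti i j N_gt2) aff_cartan_sym aij mul0r scale0r subr0.
  rewrite scalerBr !scalerA addrACA -scaleNr -!scalerDl.
  set k := (X in X *: _ + _); set l := (X in _ + X *: _).
  have -> : k = 0 by rewrite /k; field.
  have -> : l = 0 by rewrite /l; field.
  by rewrite !scale0r addr0.
have Tz : T i (ht j + s) = ht j + s.
  exact: expad3_invariant (inv true) (inv false).
have [_ Th _] := braid_degree0 i.
(* Invariance gives T_i(ht_j) = ht_j + s - T_i(s), and T_i(s) is known from the case i = j. *)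
rewrite -[ht j in LHS](addrK s) braidB Tz braidD !braidZ Th braid_ht_diag.
rewrite !scalerN scalerBr scalerN -!opprD opprK [2^-1 *: (hbar *: _)]scalerA.
rewrite [2^-1 * _]mulrC /s.
move: (ht j) (ht i) (_ *: anti _ _) (_ *: h i) => t p r q.
have half (v : Y) : 2^-1 *: v + 2^-1 *: v = v.
  by rewrite -scalerDr -mulr2n -scaler_nat scalerA mulVf ?pnatr_eq0 // scale1r.
rewrite -addrA [_ + r + _]addrAC [_ + (_ + r)]addrA addrACA !half.
by rewrite addrAC !addrA.
Qed.

(** * The action of T_i at an orthogonal node, a_ij = 0 *)

Lemma braid_ortho i j : aff_cartan i j = 0 ->
  T i (ht j) = ht j /\ forall b, T i (x b j 1) = x b j 1.
Proof.
move=> aij; have ne_ij : i != j.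
  by apply/eqP => eq_ij; move: aij; rewrite eq_ij aff_cartan_refl.
have same b c' : lie (x b i 0) (x c' j 1) = 0.
  have [<-|ne_bc] := eqVneq b c'; last first.
    by rewrite -(lie_x_opp_ne b 1 ne_ij); case: b c' ne_bc => [] [].
  (* Here 1 - a_ij = 1, so the Serre relation is a single bracket. *)
  by have := yangian_serre_iter b 1 ne_ij; rewrite aij.
split=> [|b]; apply: expad3_invariant; rewrite ?same //;
  by rewrite lie_xht aff_cartan_sym aij mulr0 oppr0 scale0r.
Qed.

End BraidDegreeOne.

Theorem proposition3p9 (R : realType) (N : nat) (e1 e2 : R[i]) (i j : 'Z_N) :
  (3 <= N)%N ->
  let hbar : R[i] := e1 + e2 in
  let xp : 'Z_N -> nat -> yangian N e1 e2 := yxp e1 e2 in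
  let xm : 'Z_N -> nat -> yangian N e1 e2 := yxm e1 e2 in
  let h : 'Z_N -> nat -> yangian N e1 e2 := yh e1 e2 in
  let ht : 'Z_N -> yangian N e1 e2 := yht e1 e2 in
  let T : 'Z_N -> yangian N e1 e2 -> yangian N e1 e2 := @braid R[i] N e1 e2 in
  [/\ [/\ (i = j -> T i (xp j 1%N) = - xm i 1%N + (hbar / 2) *: anti (h i 0%N) (xm i 0%N)),
          (aff_cartan i j = -1 -> T i (xp j 1%N) = lie (xp i 0%N) (xp j 1%N)) &
          (aff_cartan i j = 0 -> T i (xp j 1%N) = xp j 1%N)],
      [/\ (i = j -> T i (xm j 1%N) = - xp i 1%N + (hbar / 2) *: anti (h i 0%N) (xp i 0%N)),
          (aff_cartan i j = -1 -> T i (xm j 1%N) = - lie (xm i 0%N) (xm j 1%N)) &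
          (aff_cartan i j = 0 -> T i (xm j 1%N) = xm j 1%N)] &
      [/\ (i = j -> T i (ht j) = - ht i - hbar *: anti (xp i 0%N) (xm i 0%N)),
          (aff_cartan i j = -1 ->
             T i (ht j) = ht j + ht i + (hbar / 2) *: anti (xp i 0%N) (xm i 0%N)
                          + ((aff_skew i j)%:~R * ((e1 - e2) / 2)) *: h i 0%N) &
          (aff_cartan i j = 0 -> T i (ht j) = ht j)]].
Proof.
move=> N_ge3 hbar xp xm h ht T; rewrite /hbar /xp /xm /h /ht /T.
split; split=> [<-|aij|aij].
- exact: (braid_x1_diag _ _ true).
- exact: (braid_x1_adj _ _ aij).1.
- exact: (braid_ortho _ _ aij).2.
- exact: (braid_x1_diag _ _ false).
- exact: (braid_x1_adj _ _ aij).2.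
- exact: (braid_ortho _ _ aij).2.
- exact: braid_ht_diag.
(* The bound [3 <= N] is [2 < N] by definition; it enters through m_ji = - m_ij. *)
- exact: braid_ht_adj.
- exact: (braid_ortho _ _ aij).1.
Qed.
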